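(* Let $n\ge3$ and let $C_n$ be the cycle on $n$ vertices with given edge densities $\gamma_e\in[0,1]$ ($e\in E(C_n)$). Assume that for each proper labeling $f$ of $C_n$ the weights of the weighted monotone-path tree $T_f(C_n)$, taken as edge densities, ensure the existence of $T_f(C_n)$ as a transversal. Then the densities $(\gamma_e)_{e\in E(C_n)}$ ensure the existence of $C_n$ as a transversal.
   Context: A proper labeling of a graph $H$ on $n$ vertices is a bijection $f:\{1,\dots,n\}\to V(H)$ such that $\{f(1),\dots,f(k)\}$ induces a connected subgraph of $H$ for all $1\le k\le n$. Given $H$ with edge weights in $[0,1]$ and a proper labeling $f$, the weighted monotone-path tree $T_f(H)$ has as vertices the paths $f(i_1)f(i_2)\cdots f(i_k)$ of $H$ ($k\ge1$) with $1=i_1<i_2<\dots<i_k$; two such paths are adjacent if one is the extension of the other by exactly one new (last) vertex; the weight of the edge joining $f(i_1)\cdots f(i_{k-1})$ and $f(i_1)\cdots f(i_k)$ is the weight of the edge $f(i_{k-1})f(i_k)$ of $H$. A weighted blow-up graph $G[K]$ of a graph $K$ is a graph whose vertex set is the disjoint union of finite nonempty clusters $A_v$ ($v\in V(K)$), whose edges only join vertices of $A_u$ to vertices of $A_v$ with $uv\in E(K)$ (not necessarily all such pairs), together with non-negative vertex weights $w$ such that the total weight of each cluster is $1$. For $uv\in E(K)$ the density is $d(A_u,A_v)=\sum w(x)w(y)$, the sum running over all edges $xy$ of $G[K]$ with $x\in A_u$, $y\in A_v$. $G[K]$ contains $K$ as a transversal if one can choose $\varphi(v)\in A_v$ for every $v\in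 V(K)$ such that $\varphi(u)\varphi(v)\in E(G[K])$ for every $uv\in E(K)$. Numbers $(\gamma_e)_{e\in E(K)}$ ensure the existence of $K$ as a transversal if every weighted blow-up graph of $K$ with $d(A_u,A_v)\ge\gamma_{uv}$ for all $uv\in E(K)$ contains $K$ as a transversal. *)

(* Defs.v *)
From HB Require Import structures.
From mathcomp Require Import all_boot all_order all_algebra.
From mathcomp Require Import reals.
Set Implicit Arguments.
Unset Strict Implicit.
Unset Printing Implicit Defensive.
Import Order.TTheory GRing.Theory Num.Theory.
Local Open Scope ring_scope.

(* A simple graph is a symmetric irreflexive relation on a finType.
   Edge weights are functions of two vertices: only their values on edges
   matter, and there they are required to be symmetric. *)

Definition cycle_adj (n : nat) : rel 'I_n :=
  fun i j => (j == ordS i) || (i == ordS j).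

Definition induced_connected (V : finType) (e : rel V) (A : {set V}) : Prop :=
  forall x y : V, x \in A -> y \in A ->
    connect [rel u v | [&& u \in A, v \in A & e u v]] x y.

(* Labels are 0, ..., n-1 instead of 1, ..., n. *)
Definition proper_labeling (n : nat) (V : finType) (e : rel V)
    (f : 'I_n -> V) : Prop :=
  bijective f /\
  forall k : nat, (1 <= k <= n)%N ->
    induced_connected e [set f i | i : 'I_n & (i < k)%N].

(* Since f is injective, the path f(i_1) ... f(i_k) is represented by its
   sequence of labels i_1 < ... < i_k, which has at most n terms. *)
Definition monotone_path (n : nat) (V : finType) (e : rel V) (f : 'I_n -> V)
    (s : n.-bseq 'I_n) : bool :=
  if bseqval s is i :: s' then
    (val i == 0%N) && path (fun a b : 'I_n => (a < b)%N && e (f a) (f b)) i s'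
  else false.

Definition mpt_vertex (n : nat) (V : finType) (e : rel V) (f : 'I_n -> V)
    : finType :=
  {s : n.-bseq 'I_n | monotone_path e f s}.

Definition mpt_labels (n : nat) (V : finType) (e : rel V) (f : 'I_n -> V)
    (p : mpt_vertex e f) : seq 'I_n := bseqval (val p).

Definition mpt_adj (n : nat) (V : finType) (e : rel V) (f : 'I_n -> V)
    : rel (mpt_vertex e f) :=
  fun p q => [exists i : 'I_n, (mpt_labels q == rcons (mpt_labels p) i)
                            || (mpt_labels p == rcons (mpt_labels q) i)].

(* When q extends p by one vertex, the last vertices of p and q are
   f(i_{k-1}) and f(i_k). Sequences in mpt_vertex are never empty, so the
   default value 0 is not used. *)
Definition mpt_weight (R : realType) (n : nat) (V : finType) (e : rel V)
    (gamma : V -> V -> R) (f : 'I_n -> V) (p q : mpt_vertex e f) : R :=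
  match mpt_labels p, mpt_labels q with
  | i :: s, j :: t => gamma (f (last i s)) (f (last j t))
  | _, _ => 0
  end.

Record weighted_blowup (R : realType) (V : finType) (e : rel V) :=
  WeightedBlowup {
    bvertex : finType;
    cluster : bvertex -> V; (* A_v is the fibre of v *)
    badj : rel bvertex;
    bweight : bvertex -> R;
    cluster_nonempty : forall v, exists x, cluster x = v;
    badj_sym : symmetric badj;
    badj_cluster : forall x y, badj x y -> e (cluster x) (cluster y);
    bweight_ge0 : forall x, 0 <= bweight x;
    cluster_weight : forall v, \sum_(x | cluster x == v) bweight x = 1
  }.

Definition density (R : realType) (V : finType) (e : rel V)
    (G : weighted_blowup R e) (u v : V) : R :=
  \sum_(x : bvertex G | cluster x == u)
    \sum_(y : bvertex G | (cluster y == v) && badj x y)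
      bweight x * bweight y.

Definition has_transversal (R : realType) (V : finType) (e : rel V)
    (G : weighted_blowup R e) : Prop :=
  exists phi : V -> bvertex G,
    (forall v, cluster (phi v) = v) /\
    (forall u v, e u v -> badj (phi u) (phi v)).

Definition ensures_transversal (R : realType) (V : finType) (e : rel V)
    (gamma : V -> V -> R) : Prop :=
  forall G : weighted_blowup R e,
    (forall u v, e u v -> gamma u v <= density G u v) -> has_transversal G.

Lemma cycle_adj_sym (n : nat) : symmetric (@cycle_adj n).
Proof. by move=> i j; rewrite /cycle_adj orbC. Qed.

Lemma cycle_adj_irr (n : nat) : (1 < n)%N -> irreflexive (@cycle_adj n).
Proof.
move=> n_gt1 i; rewrite /cycle_adj orbb; apply/eqP => /(congr1 val) /=.
have := ltn_ord i; rewrite leq_eqVlt => /orP[/eqP iE | lt_i].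
  by rewrite iE modnn => i0; move: n_gt1; rewrite -iE i0.
by rewrite modn_small // => /n_Sn.
Qed.

Lemma mpt_adj_sym (n : nat) (V : finType) (e : rel V) (f : 'I_n -> V) :
  symmetric (@mpt_adj n V e f).
Proof. by move=> p q; apply: eq_existsb => i; rewrite orbC. Qed.

Lemma mpt_adj_irr (n : nat) (V : finType) (e : rel V) (f : 'I_n -> V) :
  irreflexive (@mpt_adj n V e f).
Proof.
move=> p; apply/negbTE/existsPn => i; rewrite orbb.
by apply/eqP => /(congr1 size); rewrite size_rcons => /n_Sn.
Qed.

(* Main.v *)
Require Import Defs.
From mathcomp Require Import all_boot all_order all_algebra.
From mathcomp Require Import reals boolp zify ring lra.
Set Implicit Arguments.
Unset Strict Implicit.
Unset Printing Implicit Defensive.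
Import Order.TTheory GRing.Theory Num.Theory.
Local Open Scope ring_scope.

(** Cutting the cycle at the vertex labelled last turns it into its monotone-path
tree: since only that vertex can be reached from both sides, the tree is the
path v, v+1, ..., v+n = v in which v occurs as both end points.  So the
hypothesis says that every such cut path is ensured, and it suffices to turn a
blow-up of the cycle without transversal into a bad blow-up of one cut path.

A path is bad as soon as there are weights beta_0 = 1, ..., beta_n = 0 with
beta_i (1 - beta_{i+1}) <= r_i, where r_i is one minus the density of the i-th
edge ([blocked]): give cluster i a good vertex of weight beta_i and a bad one
of weight 1 - beta_i, and remove the edges from good to bad.  A transversal
would start good, stay good and end bad ([cut_blowup_no_transversal]).

For a blow-up of the cycle without transversal, keep the graph and choose
vertex weights that satisfy the density conditions and have minimal support.
Such weights are [rigid]: no perturbation inside the support can be pushed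
until a weight vanishes.  Linear algebra in three unknowns then shows that each
cluster carries at most two vertices of positive weight, and that if it carries
two, one (called a) has the smaller weight of non-neighbours in the next
cluster while the other (called b) has the smaller one in the previous cluster
([rigid_clusterP]).

If a cluster carries a single vertex, the sets reached from it while going
around the cycle give the weights beta ([single_point_blocked]).  Otherwise let
B_i be the weight of b_i.  The comparisons of a and b leave few shapes for the
bipartite graph between consecutive clusters ([two_point_edge]): one always has
B_i (1 - B_{i+1}) <= r_i, and a bad path can start at a missing
edge aa and end at a missing edge bb.  As the all-a and all-b choices are
not transversals, there are missing edges aa and bb.  If they can be found at
different places, following the weights B_i from the first to the second gives
the bad path.  If they occur only at one common place, then either ba is present
there, and one can close up a transversal, or ba is missing there too.

In this last case the two cuts at the ends of that place are compared: for given
r_i, the product of B_1 with the weight that survives at the end is concave in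
B_1, so the bound that fails at an intermediate B_1 fails at one of the two
extreme values, which are the two cut paths ([one_open_edge_blocked]). *)

(** * Blocked paths *)

(** [r i] is the weight of missing pairs allowed on the i-th edge of a path with
n edges; [beta i] is the weight of the vertices of the i-th cluster that can be
reached from the initial one. *)
Definition blocked (R : realType) (r : nat -> R) (n : nat) : Prop :=
  exists beta : nat -> R,
    [/\ forall i, 0 <= beta i <= 1, beta 0%N = 1, beta n = 0
      & forall i, (i < n)%N -> beta i * (1 - beta i.+1) <= r i].

(** The weight that can be reached in the k-th cluster in the worst case: all
missing pairs of an edge are spent on separating the reached vertices from
a set of unreachable ones. *)
Fixpoint surviving (R : realType) (r : nat -> R) (k : nat) : R :=
  if k is k'.+1 then 1 - r k' / surviving r k' else 1.

(** The recursion is optimal: at the first index where it fails to be positive, its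
earlier values, continued by zero, block the path. *)
Lemma surviving_gt0 (R : realType) (r : nat -> R) (n k : nat) :
  (forall i, 0 <= r i) -> ~ blocked r n -> (k <= n)%N -> 0 < surviving r k.
Proof.
move=> r_ge0 unblocked; have [m] := ubnP k; elim: m k => // m IH k lt_km le_kn.
rewrite real_ltNge ?num_real //; apply/negP => surv_le0; apply: unblocked.
case: k => [|k] in lt_km le_kn surv_le0; first by move: surv_le0 => /=; lra.
have surv_gt0 j : (j <= k)%N -> 0 < surviving r j by move=> le_jk; apply: IH; lia.
exists (fun i => if (i <= k)%N then surviving r i else 0); split=> //.
- move=> i; case: leqP => [le_ik|]; last by lra.
  rewrite ltW ?surv_gt0 //=; case: i le_ik => [|i] le_ik //=.
  by rewrite lerBlDr lerDl divr_ge0 // ltW ?surv_gt0 // ltnW.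
- by rewrite leqNgt le_kn.
- move=> i lt_in; case: (ltngtP i k) => [lt_ik|gt_ik|eq_ik].
  + have /gt_eqF/negbT := surv_gt0 _ (ltnW lt_ik).
    by move=> ?; rewrite /= subKr mulrC divfK.
  + by rewrite mul0r.
  + rewrite eq_ik; have := surv_gt0 _ (leqnn k).
    move: surv_le0; rewrite /= subr_le0 => le1 gt0.
    by move: le1; rewrite ler_pdivlMr // mul1r subr0 mulr1.
Qed.

(** Convexity of the inverse function, combined with its monotonicity; this is
what propagates concavity through one step of [surviving]. *)
Lemma weighted_harmonic_mean (R : realType) (p q x y z : R) :
    0 <= p -> 0 <= q -> 0 < x -> 0 < y -> 0 < z ->
  p * x + q * y <= (p + q) * z -> (p + q) / z <= p / x + q / y.
Proof.
move=> p0 q0 x0 y0 z0 le_z; rewrite ler_pdivrMr //.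
have -> : (p / x + q / y) * z = (p * y + q * x) * z / (x * y).
  by field; rewrite !gt_eqF.
rewrite ler_pdivlMr ?mulr_gt0 //.
case: (eqVneq (p + q) 0) => [pq0|pq_neq0].
  have pE : p = 0 by lra.
  have qE : q = 0 by lra.
  by rewrite pE qE !(mul0r, addr0).
have pq0 : 0 < p + q by rewrite lt0r pq_neq0 addr_ge0.
rewrite -(ler_pM2l pq0).
have le1 : (p * x + q * y) * (p * y + q * x) <= (p + q) * z * (p * y + q * x).
  by rewrite ler_wpM2r // addr_ge0 // mulr_ge0 // ltW.
have pq_ge0 : 0 <= p * q * (x - y) ^+ 2.
  by apply: mulr_ge0; [exact: mulr_ge0 | exact: sqr_ge0].
apply: le_trans (_ : (p * x + q * y) * (p * y + q * x) <= _); last first.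
  by apply: le_trans le1 _; rewrite le_eqVlt; apply/orP; left; apply/eqP; ring.
rewrite -subr_ge0.
by have -> : (p * x + q * y) * (p * y + q * x) - (p + q) * ((p + q) * (x * y))
  = p * q * (x - y) ^+ 2 by ring.
Qed.

(** The cycle has one exceptional edge, edge 0, where only pairs formed by the
unreached part 1 - B n and the reached part B 1 are joined.  The two extreme
ways to realize the density g = 1 - r 0 of that edge are B 1 = g with B n = 0,
which is the path cut at 0, and B 1 = 1 with B n = r 0, which is the path
cut at 1.  Write t = B 1 as p + l with p = g (1 - l).  By induction, t times
B k lies above the corresponding combination of the two extreme recursions,
and at k = n this contradicts the density of edge 0 if both recursions stay
positive. *)
Lemma one_open_edge_blocked (R : realType) (n : nat) (r B : nat -> R) :
    (3 <= n)%N -> (forall i, 0 <= r i) -> r n = r 0%N ->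
    (forall i, 0 <= B i <= 1) ->
    (forall i, (0 < i < n)%N -> B i * (1 - B i.+1) <= r i) ->
    1 - r 0%N <= B 1%N * (1 - B n) ->
  blocked r n \/ blocked (fun i => r i.+1) n.
Proof.
case: n => [|[|[|m]]] //; set n := m.+3 => _ r_ge0 r_per B01 Br B0.
have [|unblocked0] := pselect (blocked r n); first by left.
have [|unblocked1] := pselect (blocked (fun i => r i.+1) n); first by right.
exfalso.
pose x := surviving r; pose y := surviving (fun i => r i.+1).
have x_gt0 k : (k <= n)%N -> 0 < x k by exact: surviving_gt0.
have y_gt0 k : (k <= n)%N -> 0 < y k by apply: surviving_gt0 => // i.
pose g := 1 - r 0%N; pose t := B 1%N.
have g_gt0 : 0 < g.
  by have := x_gt0 1%N isT; rewrite /x /= divr1.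
have g_le1 : g <= 1 by rewrite /g; have := r_ge0 0%N; lra.
have /andP[t_ge0 t_le1] := B01 1%N.
have /andP[Bn_ge0 Bn_le1] := B01 n.
have gt : g <= t by rewrite /g /t; nra.
(* t = (1 - l) g + l 1, a convex combination of the two extreme values of B 1;
   if g = 1, the quotient is 0 and so is l. *)
pose l := (t - g) / (1 - g); pose p := g * (1 - l).
have [l_ge0 l_le1 ptl] : [/\ 0 <= l, l <= 1 & p + l = t].
  case: (eqVneq g 1) => [g1|g_neq1].
    have t1 : t = 1 by rewrite -/t in t_le1; lra.
    by rewrite /p /l g1 t1 subrr mul0r; split; lra.
  have g_lt1 : g < 1 by rewrite lt_neqAle g_neq1.
  split; rewrite /p /l.
  - by rewrite divr_ge0; lra.
  - rewrite ler_pdivrMr; last lra.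
    by rewrite -/t in t_le1; lra.
  - by field; lra.
have p_ge0 : 0 <= p by rewrite /p mulr_ge0; lra.
have pos k : (0 < k)%N -> (k <= n)%N -> 0 < p * x k + l * y k.-1.
  move=> k_gt0 le_kn; have x0 := x_gt0 k le_kn;
    have y0 : 0 < y k.-1 by apply: y_gt0; apply: leq_trans (leq_pred _) le_kn.
  case: (eqVneq l 0) => [l0|l_neq0].
    by rewrite l0 mul0r addr0 mulr_gt0 //; lra.
  have l_gt0 : 0 < l by rewrite lt0r l_neq0.
  by apply: ltr_wpDl; [exact: mulr_ge0 (ltW x0) | exact: mulr_gt0].
(* The chord inequality fails at index 1, where t B 1 is convex in t; at index 2
   it is an equality. *)
have chord k : (k.+2 <= n)%N -> p * x k.+2 + l * y k.+1 <= t * B k.+2.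
  elim: k => [|k IH] le_kn.
    have := Br 1%N isT; rewrite -/t /x /y /= !divr1 -/g => Br1.
    suff -> : p * (1 - r 1%N / g) + l * (1 - r 1%N) = t - r 1%N by lra.
    by rewrite -ptl /p; field; lra.
  have {}IH := IH (ltnW le_kn).
  have pos_k := pos k.+2 isT (ltnW le_kn).
  have /andP[Bk_ge0 _] := B01 k.+2.
  have Bk_gt0 : 0 < B k.+2.
    by rewrite lt0r Bk_ge0 andbT; apply/eqP => Bk0; move: IH pos_k;
      rewrite Bk0 mulr0 /=; lra.
  have xk := x_gt0 k.+2 (ltnW le_kn); have yk := y_gt0 k.+1 (ltnW (ltnW le_kn)).
  have l_p : p + l = t by [].
  have := weighted_harmonic_mean p_ge0 l_ge0 xk yk Bk_gt0.
  rewrite l_p => /(_ IH) => harm.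
  have le_B : 1 - r k.+2 / B k.+2 <= B k.+3.
    rewrite lerBlDr -lerBlDl ler_pdivlMr // mulrC.
    exact: Br.
  have -> : p * x k.+3 + l * y k.+2
          = t - r k.+2 * (p / x k.+2 + l / y k.+1).
    by rewrite -ptl /x /y /=; ring.
  have := ler_wpM2l t_ge0 le_B; have := ler_wpM2l (r_ge0 k.+2) harm.
  rewrite -/t.
  have -> : t * (1 - r k.+2 / B k.+2) = t - r k.+2 * (t / B k.+2) by ring.
  by lra.
have final := chord m.+1 (leqnn n).
have yn : r 0%N < y m.+2.
  have yn0 : 0 < y m.+2 by apply: y_gt0.
  have := y_gt0 n (leqnn n); rewrite /y /= -/(y m.+2) -/n r_per subr_gt0.
  by rewrite ltr_pdivrMr // mul1r.
have xn := x_gt0 n (leqnn n).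
have ty : t * B n <= l * r 0%N.
  have -> : l * r 0%N = t - g by rewrite -ptl /p /g; ring.
  by move: B0; rewrite -/g -/t; lra.
have px : 0 <= p * x n by rewrite mulr_ge0 // ltW.
have ly : l * r 0%N <= l * y m.+2 by rewrite ler_wpM2l // ltW.
case: (eqVneq l 0) => [l0|l_neq0].
  have : 0 < p * x n by rewrite mulr_gt0 //; lra.
  by lra.
have l_gt0 : 0 < l by rewrite lt0r l_neq0.
have : l * r 0%N < l * y m.+2 by rewrite ltr_pM2l.
by lra.
Qed.

(** * Monotone paths of a cycle cut at one vertex *)

Definition cyc (n : nat) (n_gt0 : (0 < n)%N) (i : nat) : 'I_n :=
  Ordinal (ltn_pmod i n_gt0).

Lemma ordS_cyc (n : nat) (n_gt0 : (0 < n)%N) (i : nat) :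
  ordS (cyc n_gt0 i) = cyc n_gt0 i.+1.
Proof. by apply: val_inj => /=; rewrite -addn1 modnDml addn1. Qed.

Lemma cyc_period (n : nat) (n_gt0 : (0 < n)%N) (i : nat) :
  cyc n_gt0 (i + n) = cyc n_gt0 i.
Proof. by apply: val_inj => /=; rewrite modnDr. Qed.

Lemma cyc_ord (n : nat) (n_gt0 : (0 < n)%N) (u : 'I_n) : cyc n_gt0 u = u.
Proof. by apply: val_inj => /=; rewrite modn_small. Qed.

Lemma cyc_addlI (n : nat) (n_gt0 : (0 < n)%N) (v i j : nat) :
  (i < n)%N -> (j < n)%N -> cyc n_gt0 (v + i) = cyc n_gt0 (v + j) -> i = j.
Proof.
move=> lt_in lt_jn /(congr1 val) /= /eqP.
by rewrite eqn_modDl !modn_small // => /eqP.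
Qed.

Lemma cyc_adj (n : nat) (n_gt0 : (0 < n)%N) (i : nat) :
  cycle_adj (cyc n_gt0 i) (cyc n_gt0 i.+1).
Proof. by rewrite /cycle_adj ordS_cyc eqxx. Qed.

(** The labels increase along the cycle from v + 1, so that v comes last. *)
Definition cut_labeling (n : nat) (n_gt0 : (0 < n)%N) (v : nat) (k : 'I_n) :
  'I_n := cyc n_gt0 (v.+1 + k).

Lemma cut_labeling_proper (n : nat) (n_gt0 : (0 < n)%N) (v : nat) :
  proper_labeling (@cycle_adj n) (cut_labeling n_gt0 v).
Proof.
have f_inj : injective (cut_labeling n_gt0 v).
  by move=> i j /cyc_addlI ij; apply: val_inj; apply: ij.
split; first exact: injF_bij.
move=> k /andP[k_gt0 le_kn]; set A := [set _ | _ in _].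
pose e := [rel x y | [&& x \in A, y \in A & cycle_adj x y]].
have e_sym : symmetric e by move=> x y; rewrite /= cycle_adj_sym andbCA.
have to_first (i : nat) : (i < k)%N ->
    connect e (cyc n_gt0 (v.+1 + 0)) (cyc n_gt0 (v.+1 + i)).
  have inA j : (j < k)%N -> cyc n_gt0 (v.+1 + j) \in A.
    move=> lt_jk; apply/imsetP; exists (Ordinal (leq_trans lt_jk le_kn)) => //.
    by rewrite inE.
  elim: i => [|i IH] lt_ik; first exact: connect0.
  apply: connect_trans (IH (ltnW lt_ik)) (connect1 _).
  by rewrite /= !inA ?(ltnW lt_ik) // [(_ + i.+1)%N]addnS cyc_adj.
move=> x y /imsetP[i + ->] /imsetP[j + ->]; rewrite !inE => lt_ik lt_jk; rewrite -/e.
apply: connect_trans (to_first _ lt_jk).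
by rewrite sym_connect_sym // to_first.
Qed.

Definition last_label (n : nat) (V : finType) (e : rel V) (f : 'I_n -> V)
    (p : mpt_vertex e f) : nat := last 0%N [seq val i | i <- mpt_labels p].

(** The position of the end point of a monotone path along v, v+1, ..., v+n.  The
only tree vertex that does not follow the increasing labels is the path from
the first label directly to the last one: it is the second copy of v, at
position 0. *)
Definition cut_position (n : nat) (V : finType) (e : rel V) (f : 'I_n -> V)
    (p : mpt_vertex e f) : nat :=
  if (size (mpt_labels p) == 2) && (last_label p == n.-1) then 0%N
  else (last_label p).+1.

Lemma cut_position_le (n : nat) (V : finType) (e : rel V) (f : 'I_n -> V)
    (p : mpt_vertex e f) : (0 < n)%N -> (cut_position p <= n)%N.
Proof.
move=> n_gt0; rewrite /cut_position; case: ifP => // _; rewrite /last_label.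
by case: (lastP (mpt_labels p)) => //= s i; rewrite map_rcons last_rcons.
Qed.

Lemma increasing_path_last (n : nat) (P : rel 'I_n) (i : 'I_n) (s : seq 'I_n) :
  path (fun a b : 'I_n => (a < b)%N && P a b) i s -> (i + size s <= last i s)%N.
Proof.
elim: s i => [|j s IH] i /=; first by rewrite addn0.
move=> /andP[/andP[lt_ij _] /IH]; rewrite -addSnnS; apply: leq_trans.
by rewrite leq_add2r.
Qed.

Lemma monotone_pathP (n : nat) (V : finType) (e : rel V) (f : 'I_n -> V)
    (p : mpt_vertex e f) :
  exists i s, [/\ mpt_labels p = i :: s, val i = 0%N
    & path (fun a b : 'I_n => (a < b)%N && e (f a) (f b)) i s].
Proof.
case: p => p; rewrite /mpt_labels /= /monotone_path.
case: (bseqval p) => // i s /[dup] + /andP[/eqP i0 s_path].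
by exists i, s.
Qed.

Lemma cut_position_rcons (n : nat) (n_gt0 : (0 < n)%N) (v : nat)
    (p q : mpt_vertex (@cycle_adj n) (cut_labeling n_gt0 v)) (j : 'I_n) :
    (3 <= n)%N -> mpt_labels q = rcons (mpt_labels p) j ->
  cut_position q = (cut_position p).+1 \/ cut_position p = (cut_position q).+1.
Proof.
move=> n_ge3; have [i [s [pE i0 p_path]]] := monotone_pathP p.
have [i' [s' [qE _ q_path]]] := monotone_pathP q.
rewrite qE pE => -[ii' s'E]; move: q_path; rewrite ii' s'E rcons_path.
case/andP=> _ /andP[lt_lj adj_lj].
have l_size := increasing_path_last p_path.
have j_lt := ltn_ord j.
rewrite /cut_position /last_label qE pE ii' s'E /= !last_map last_rcons.
rewrite size_rcons !eqSS; set l := last i s in lt_lj adj_lj l_size *.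
have [jE|[jE l0]] : j = l.+1 :> nat \/ j = n.-1 :> nat /\ l = 0%N :> nat.
  move: adj_lj; rewrite /cycle_adj /cut_labeling !ordS_cyc -!addnS.
  case/orP => /eqP; first by move/cyc_addlI=> jE; left; apply: jE; lia.
  have [lt_jn|ge_jn] := ltnP j.+1 n;
    first by move=> /(cyc_addlI (ltn_ord _) lt_jn) lE; move: lt_lj;
      rewrite lE ltnNge leqnSn.
  have -> : (j.+1 = 0 + n)%N by lia.
  by rewrite addnA cyc_period => /cyc_addlI l0; right; split; [lia | apply: l0; lia].
- have -> : (size s == 1%N) && (nat_of_ord l == n.-1) = false by rewrite -/l; lia.
  have -> : (size s == 0%N) && (nat_of_ord j == n.-1) = false.
    case: s @l l_size {pE s'E p_path adj_lj lt_lj} jE => //= _ jE.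
    by rewrite jE i0; lia.
  by left; rewrite jE.
- have s0 : size s = 0%N by move: l_size; rewrite l0; lia.
  by rewrite s0 jE l0 /= eqxx; right.
Qed.

(** * The bad blow-up of a cut path *)

Lemma sum_pair_fibre (R : realType) (V : finType) (p : V) (F : V * bool -> R) :
  \sum_(z | z.1 == p) F z = F (p, true) + F (p, false).
Proof.
rewrite (reindex_onto (fun b : bool => (p, b)) snd) /=; last by case=> a b /= /eqP->.
by rewrite (eq_bigl xpredT) ?big_bool //= => b; rewrite !eqxx.
Qed.

(** The condition on the vertices x and y (true for good) of the clusters at
positions i and j, read from i to j.  The bad vertex at position 0 and the good
one at position n have weight zero and are isolated. *)
Definition cut_compat (n i : nat) (x : bool) (j : nat) (y : bool) : bool :=
  [&& (j == i.+1) ==> x ==> y, (i == 0%N) ==> x & (i == n) ==> ~~ x].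

Lemma mpt_extend (n : nat) (V : finType) (e : rel V) (f : 'I_n -> V)
    (p : mpt_vertex e f) (l j : 'I_n) :
    last_label p = l -> (l < j)%N -> e (f l) (f j) ->
  exists q : mpt_vertex e f, mpt_labels q = rcons (mpt_labels p) j.
Proof.
move=> pl lt_lj adj_lj; have [i [s [pE i0 p_path]]] := monotone_pathP p.
have lE : last i s = l.
  by apply: val_inj; rewrite /= -pl /last_label pE /= last_map.
have size_ok : (size (rcons (i :: s) j) <= n)%N.
  rewrite size_rcons /=; apply: leq_trans (ltn_ord j); rewrite ltnS.
  by apply: leq_ltn_trans lt_lj;
    rewrite -lE (leq_trans (leq_addl i _) (increasing_path_last p_path)).
have mono : monotone_path e f (Bseq size_ok).
  by rewrite /monotone_path /= i0 eqxx rcons_path p_path lE lt_lj.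
by exists (Sub (Bseq size_ok) mono); rewrite pE.
Qed.

Lemma mpt_root (n : nat) (V : finType) (e : rel V) (f : 'I_n -> V) (i : 'I_n) :
  i = 0%N :> nat -> exists p : mpt_vertex e f, mpt_labels p = [:: i].
Proof.
move=> i0; have size_ok : (size [:: i] <= n)%N by apply: leq_trans (ltn_ord i).
have mono : monotone_path e f (Bseq size_ok) by rewrite /monotone_path /= i0.
by exists (Sub (Bseq size_ok) mono).
Qed.

Section CutBlowup.
Variables (R : realType) (n : nat) (n_gt0 : (0 < n)%N) (n_ge3 : (3 <= n)%N).
Variables (v : nat) (beta : nat -> R).
Hypothesis beta01 : forall i, 0 <= beta i <= 1.
Let vertex := mpt_vertex (@cycle_adj n) (cut_labeling n_gt0 v).

Definition cut_badj (x y : vertex * bool) : bool :=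
  [&& mpt_adj x.1 y.1,
      cut_compat n (cut_position x.1) x.2 (cut_position y.1) y.2
    & cut_compat n (cut_position y.1) y.2 (cut_position x.1) x.2].

Definition cut_bweight (x : vertex * bool) : R :=
  if x.2 then beta (cut_position x.1) else 1 - beta (cut_position x.1).

Lemma cut_cluster_nonempty (p : vertex) : exists x : vertex * bool, x.1 = p.
Proof. by exists (p, true). Qed.

Lemma cut_badj_sym : symmetric cut_badj.
Proof. by move=> x y; rewrite /cut_badj mpt_adj_sym [X in _ && X]andbC. Qed.

Lemma cut_badj_cluster (x y : vertex * bool) : cut_badj x y -> mpt_adj x.1 y.1.
Proof. by case/andP. Qed.

Lemma cut_bweight_ge0 (x : vertex * bool) : 0 <= cut_bweight x.
Proof. by rewrite /cut_bweight; have := beta01 (cut_position x.1); case: ifP; lra. Qed.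

Lemma cut_cluster_weight (p : vertex) : \sum_(x | x.1 == p) cut_bweight x = 1.
Proof. by rewrite sum_pair_fibre /cut_bweight /= addrC subrK. Qed.

Definition cut_blowup :
  weighted_blowup R (@mpt_adj n 'I_n (@cycle_adj n) (cut_labeling n_gt0 v)) :=
  WeightedBlowup cut_cluster_nonempty cut_badj_sym cut_badj_cluster
    cut_bweight_ge0 cut_cluster_weight.

Lemma cut_positionS (p q : vertex) : mpt_adj p q ->
  cut_position q = (cut_position p).+1 \/ cut_position p = (cut_position q).+1.
Proof.
case/existsP=> j /orP[] /eqP /(cut_position_rcons n_ge3) //.
by case; [right | left].
Qed.

Lemma cut_weightE (gamma : 'I_n -> 'I_n -> R) (p q : vertex) :
  mpt_weight gamma p q =
  gamma (cyc n_gt0 (v + cut_position p)) (cyc n_gt0 (v + cut_position q)).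
Proof.
have lastE (s : vertex) (i : 'I_n) (t : seq 'I_n) : mpt_labels s = i :: t ->
    cut_labeling n_gt0 v (last i t) = cyc n_gt0 (v + cut_position s).
  move=> sE; rewrite /cut_labeling; have -> : nat_of_ord (last i t) = last_label s.
    by rewrite /last_label sE /= last_map.
  rewrite /cut_position; case: ifP => [/andP[_ /eqP->]|_].
    rewrite addn0 -(cyc_period n_gt0 v); congr cyc; lia.
  by rewrite addSnnS.
have [i [s [pE _ _]]] := monotone_pathP p.
have [j [t [qE _ _]]] := monotone_pathP q.
by rewrite /mpt_weight pE qE -(lastE p i s pE) -(lastE q j t qE).
Qed.

Lemma cut_edge_density (i : nat) :
    beta 0%N = 1 -> beta n = 0 -> (i < n)%N ->
  1 - beta i * (1 - beta i.+1) <= \sum_(x : bool) \sum_(y : bool)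
    if cut_compat n i x i.+1 y && cut_compat n i.+1 y i x then
      (if x then beta i else 1 - beta i) * (if y then beta i.+1 else 1 - beta i.+1)
    else 0.
Proof.
move=> beta0 betan lt_in; rewrite !big_bool /cut_compat /= eqxx /=.
rewrite !(ltn_eqF lt_in) (ltn_eqF (leqW (leqnn i.+1))) /=.
have betai : i == 0%N -> beta i = 1 by move/eqP->.
have betaSi : i.+1 == n -> beta i.+1 = 0 by move/eqP->.
case: (i == 0%N) betai => [->|_] //; case: (i.+1 == n) betaSi => [->|_] //=; lra.
Qed.

Lemma cut_density (gamma : 'I_n -> 'I_n -> R) (p q : vertex) :
    (forall u w, cycle_adj u w -> gamma u w = gamma w u) ->
    beta 0%N = 1 -> beta n = 0 ->
    (forall i, (i < n)%N -> beta i * (1 - beta i.+1) <=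
       1 - gamma (cyc n_gt0 (v + i)) (cyc n_gt0 (v + i).+1)) ->
  mpt_adj p q -> mpt_weight gamma p q <= density cut_blowup p q.
Proof.
move=> gamma_sym beta0 betan defect adj_pq; rewrite cut_weightE.
have -> : density cut_blowup p q =
    \sum_(x : bool) \sum_(y : bool) if cut_badj (p, x) (q, y)
      then cut_bweight (p, x) * cut_bweight (q, y) else 0.
  rewrite /density /= sum_pair_fibre big_bool; congr (_ + _);
    by rewrite big_mkcondr sum_pair_fibre big_bool.
have p_le := cut_position_le p n_gt0; have q_le := cut_position_le q n_gt0.
case: (cut_positionS adj_pq) => posE.
- rewrite posE in q_le; have := cut_edge_density beta0 betan q_le.
  have := defect _ q_le; rewrite -addnS -posE => defect_pq density_pq.
  apply: le_trans (le_trans _ density_pq) _; first by lra.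
  by rewrite /cut_badj /cut_bweight /= adj_pq.
- rewrite posE in p_le; have := cut_edge_density beta0 betan p_le.
  have := defect _ p_le; rewrite gamma_sym ?cyc_adj // -addnS -posE.
  move=> defect_pq density_pq.
  apply: le_trans (le_trans _ density_pq) _; first by lra.
  rewrite exchange_big /cut_badj /cut_bweight /= adj_pq.
  apply: ler_sum => x _; apply: ler_sum => y _.
  by rewrite /= andbC mulrC.
Qed.

(** Going through the clusters in the order of their positions, a transversal has
to be good at position 0, stays good, and cannot be good at position n. *)
Lemma cut_blowup_no_transversal : ~ has_transversal cut_blowup.
Proof.
case=> phi [phi_cl phi_adj].
have phi1 p : (phi p).1 = p := phi_cl p.
have adj_rcons (p q : vertex) j : mpt_labels q = rcons (mpt_labels p) j -> mpt_adj p q.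
  by move=> qE; apply/existsP; exists j; rewrite qE eqxx.
have compat (p q : vertex) : mpt_adj p q ->
    cut_compat n (cut_position p) (phi p).2 (cut_position q) (phi q).2.
  by move/phi_adj => /and3P[_ + _]; rewrite !phi1.
have position (p : vertex) k : size (mpt_labels p) = k.+1 -> last_label p = k ->
    cut_position p = k.+1.
  by rewrite /cut_position => -> ->; case: ifP => //; lia.
have extend (p : vertex) k : (k.+1 < n)%N ->
    size (mpt_labels p) = k.+1 -> last_label p = k ->
    exists q : vertex, [/\ mpt_adj p q, size (mpt_labels q) = k.+2
      & last_label q = k.+1].
  move=> lt_kn sz_p lb_p.
  have lt_kn' : (k < n)%N by apply: ltnW.
  have [|||q qE] := @mpt_extend _ _ _ _ p (Ordinal lt_kn') (Ordinal lt_kn) => //.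
    by rewrite /cut_labeling /= addnS cyc_adj.
  exists q; split; first exact: adj_rcons qE.
    by rewrite qE size_rcons sz_p.
  by rewrite /last_label qE map_rcons last_rcons.
have good k : (k < n)%N -> exists p : vertex,
    [/\ size (mpt_labels p) = k.+1, last_label p = k & (k.+1 < n)%N -> (phi p).2].
  elim: k => [|k IH] lt_kn.
    (* The cluster at position 0 is adjacent to the root only, and forces its
       vertex to be good. *)
    have [p pE] := @mpt_root n _ (@cycle_adj n) (cut_labeling n_gt0 v) (Ordinal
      lt_kn) erefl.
    exists p; rewrite pE /last_label pE; split=> // _.
    have lt_n : (n.-1 < n)%N by rewrite prednK.
    have [|||q qE] := @mpt_extend _ _ _ _ p (Ordinal lt_kn) (Ordinal lt_n).
    - by rewrite /last_label pE.
    - by rewrite /=; lia.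
    - rewrite cycle_adj_sym /cut_labeling /= addn0 -(cyc_period n_gt0 v.+1).
      have -> : (v.+1 + n = (v.+1 + n.-1).+1)%N by lia.
      exact: cyc_adj.
    have q0 : cut_position q = 0%N.
      by rewrite /cut_position /last_label qE pE /= eqxx.
    have p1 : cut_position p = 1%N by apply: position; rewrite /last_label pE.
    have adj_qp : mpt_adj q p by rewrite mpt_adj_sym (adj_rcons _ _ _ qE).
    have := compat q p adj_qp; rewrite q0 p1 /cut_compat /=.
    by case: (phi q).2; case: (phi p).2; rewrite ?andbF.
  have [p [sz_p lb_p good_p]] := IH (ltnW lt_kn).
  have [q [adj_pq sz_q lb_q]] := extend p k lt_kn sz_p lb_p.
  exists q; split=> // _; have := compat p q adj_pq.
  rewrite (position p k) // (position q k.+1) // /cut_compat eqxx good_p //=.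
  by case/andP.
have [k nE] : exists k, n = k.+2 by exists n.-2; lia.
have [|p [sz_p lb_p good_p]] := good k; first by rewrite nE.
have [|q [adj_pq sz_q lb_q]] := extend p k _ sz_p lb_p; first by rewrite nE.
have := compat p q adj_pq; rewrite mpt_adj_sym in adj_pq; have := compat q p adj_pq.
rewrite (position p k) // (position q k.+1) // /cut_compat eqxx good_p ?nE //=.
by rewrite eqxx; case: (phi q).2; rewrite ?andbF.
Qed.
End CutBlowup.

(** The hypothesis on trees as a statement about sequences of reals. *)
Lemma unblocked_of_trees (R : realType) (n : nat) (n_gt0 : (0 < n)%N)
    (gamma : 'I_n -> 'I_n -> R) (v : nat) :
    (3 <= n)%N -> (forall u w, cycle_adj u w -> gamma u w = gamma w u) ->
    ensures_transversal (@mpt_adj n 'I_n (@cycle_adj n) (cut_labeling n_gt0 v))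
      (mpt_weight gamma (f := cut_labeling n_gt0 v)) ->
  ~ blocked (fun i => 1 - gamma (cyc n_gt0 (v + i)) (cyc n_gt0 (v + i).+1)) n.
Proof.
move=> n_ge3 gamma_sym trees [beta [beta01 beta0 betan defect]].
apply: (@cut_blowup_no_transversal R n n_gt0 n_ge3 v beta beta01).
by apply: trees => p q; exact: cut_density.
Qed.

(** * Weights of minimal support *)

Section Weightings.
Variables (R : realType) (n : nat) (X : finType) (cl : X -> 'I_n) (adj : rel X).
Variable r : 'I_n -> R.

(** The weight of the missing pairs between cluster u and the next one, as a
bilinear form, so that weights can be perturbed. *)
Definition gap (w w' : X -> R) (u : 'I_n) : R :=
  \sum_(x | cl x == u) \sum_(y | (cl y == ordS u) && ~~ adj x y) w x * w' y.

Definition admissible (w : X -> R) : Prop :=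
  [/\ forall x, 0 <= w x, forall u, \sum_(x | cl x == u) w x = 1
    & forall u, gap w w u <= r u].

(** No direction supported where w is positive preserves the cluster weights
without increasing the missing weight of some edge. *)
Definition rigid (w : X -> R) : Prop :=
  forall z : X -> R, (forall x, w x = 0 -> z x = 0) ->
    (forall u, \sum_(x | cl x == u) z x = 0) ->
    (forall u, gap z w u <= 0) -> (forall u, gap w z u <= 0) ->
    (forall u, gap z z u <= 0) ->
  forall x, z x = 0.

Lemma gap_translate (w z : X -> R) (t : R) (u : 'I_n) :
  gap (fun x => w x + t * z x) (fun x => w x + t * z x) u =
  gap w w u + t * (gap z w u + gap w z u + t * gap z z u).
Proof.
rewrite /gap [t * gap _ _ _]mulr_sumr -!big_split /= mulr_sumr -big_split /=.
apply: eq_bigr => x _.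
rewrite [t * \sum_(y | _) _]mulr_sumr -!big_split /= mulr_sumr -big_split /=.
by apply: eq_bigr => y _; ring.
Qed.

(** Move along z until the first weight vanishes. *)
Lemma admissible_shrink (w z : X -> R) :
    admissible w -> (forall x, w x = 0 -> z x = 0) ->
    (forall u, \sum_(x | cl x == u) z x = 0) ->
    (forall u, gap z w u <= 0) -> (forall u, gap w z u <= 0) ->
    (forall u, gap z z u <= 0) -> (exists x, z x != 0) ->
  exists w', admissible w' /\ (#|[set x | w' x != 0%R]| < #|[set x | w x != 0%R]|)%N.
Proof.
move=> [w_ge0 w_sum w_gap] z_supp z_sum zw_le0 wz_le0 zz_le0 [x1 zx1].
have [x2 zx2] : exists x, z x < 0.
  have [zx1_lt0|] := ltP (z x1) 0; first by exists x1.
  rewrite le_eqVlt eq_sym (negbTE zx1) /= => zx1_gt0.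
  apply: contrapT => /forallNP z_ge0.
  have {}z_ge0 x : 0 <= z x by rewrite leNgt; apply/negP/z_ge0.
  have := z_sum (cl x1); rewrite (bigD1 x1) //= => /eqP.
  by rewrite paddr_eq0 ?sumr_ge0 // gt_eqF.
(* x0 is the vertex whose weight vanishes first. *)
pose x0 := [arg min_(x < x2 | z x < 0) (w x / - z x)]%O.
have [zx0 x0_min] : z x0 < 0 /\ forall x, z x < 0 -> w x0 / - z x0 <= w x / - z x.
  by rewrite /x0; case: arg_minP => [|x zx x_min].
pose t := w x0 / - z x0; have t_ge0 : 0 <= t by rewrite divr_ge0 // oppr_ge0 ltW.
exists (fun x => w x + t * z x); split; first split.
- move=> x; have [zx_lt0|zx_ge0] := ltP (z x) 0; last first.
    by apply: addr_ge0 => //; apply: mulr_ge0.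
  have := x0_min x zx_lt0; rewrite -/t ler_pdivlMr ?oppr_gt0 //; lra.
- by move=> u; rewrite big_split /= -mulr_sumr z_sum mulr0 addr0.
- move=> u; rewrite gap_translate; apply: le_trans (w_gap u).
  rewrite gerDl mulr_ge0_le0 //.
  by have := mulr_ge0_le0 t_ge0 (zz_le0 u); move: (zw_le0 u) (wz_le0 u); lra.
apply: proper_card; apply/properP; split.
  apply/subsetP => x; rewrite !inE; apply: contra => /eqP wx0.
  by rewrite wx0 z_supp // mulr0 addr0.
exists x0; rewrite !inE.
  by apply: contraTneq zx0 => /z_supp ->; rewrite ltxx.
by rewrite negbK /t; apply/eqP; field; rewrite ltr0_neq0.
Qed.

Lemma admissible_rigid (w : X -> R) :
  admissible w -> exists w', admissible w' /\ rigid w'.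
Proof.
have [k] := ubnP #|[set x | w x != 0]|; elim: k w => // k IH w lt_k w_adm.
have [w_rigid|] := pselect (rigid w); first by exists w.
move=> /existsNP[z] /not_implyP[z_supp] /not_implyP[z_sum] /not_implyP[zw].
move=> /not_implyP[wz] /not_implyP[zz] /existsNP[x /eqP zx].
have [|w' [w'_adm lt_w']] := admissible_shrink w_adm z_supp z_sum zw wz zz.
  by exists x.
by apply: IH w'_adm; apply: leq_trans lt_w' _.
Qed.

Definition gap_ahead (w : X -> R) (x : X) : R :=
  \sum_(y | (cl y == ordS (cl x)) && ~~ adj x y) w y.
Definition gap_behind (w : X -> R) (x : X) : R :=
  \sum_(y | (ordS (cl y) == cl x) && ~~ adj y x) w y.

Lemma gapE_ahead (w w' : X -> R) (u : 'I_n) :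
  gap w w' u = \sum_(x | cl x == u) w x * gap_ahead w' x.
Proof.
by apply: eq_bigr => x /eqP <-; rewrite mulr_sumr.
Qed.

Lemma gapE_behind (w w' : X -> R) (u : 'I_n) :
  gap w w' u = \sum_(y | cl y == ordS u) w' y * gap_behind w y.
Proof.
rewrite /gap (exchange_big_dep (fun y => cl y == ordS u)) /=; last first.
  by move=> x y _ /andP[].
apply: eq_bigr => y /eqP yu; rewrite mulr_sumr.
apply: eq_big => [x|x _]; last by rewrite mulrC.
by rewrite yu eqxx (inj_eq (@ordS_inj n)).
Qed.

Section Rigid.
Variable w : X -> R.
Hypotheses (n_gt1 : (1 < n)%N) (w_rigid : rigid w).

(** Inside a single cluster the quadratic term vanishes and rigidity becomes
a statement about two linear constraints. *)
Lemma rigid_cluster (u : 'I_n) (z : X -> R) :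
    (forall x, z x != 0 -> cl x = u /\ w x != 0) ->
    \sum_(x | cl x == u) z x = 0 ->
    \sum_(x | cl x == u) z x * gap_ahead w x <= 0 ->
    \sum_(x | cl x == u) z x * gap_behind w x <= 0 ->
  forall x, z x = 0.
Proof.
move=> z_supp z_sum z_ahead z_behind.
have z_out x u' : cl x == u' -> u' != u -> z x = 0.
  by move=> /eqP <-; apply: contraNeq => /z_supp[-> _].
apply: w_rigid => [x wx0|u'|u'|u'|u'].
- by apply: contra_eq wx0 => /z_supp[].
- have [->//|u'u] := eqVneq u' u.
  by rewrite big1 // => x /z_out ->.
- rewrite gapE_ahead; have [->//|u'u] := eqVneq u' u.
  by rewrite big1 // => x /z_out ->; rewrite ?mul0r.
- rewrite gapE_behind; have [->//|u'u] := eqVneq (ordS u') u.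
  by rewrite big1 // => x /z_out ->; rewrite ?mul0r.
- rewrite gapE_ahead big1 // => x xu'; have [u'u|u'u] := eqVneq u' u; last first.
    by rewrite (z_out x u') ?mul0r.
  rewrite /gap_ahead big1 ?mulr0 // => y /andP[yu _]; apply: z_out yu _.
  rewrite (eqP xu') u'u; have := cycle_adj_irr n_gt1 u.
  by rewrite /cycle_adj orbb eq_sym => ->.
Qed.

(** Otherwise all the weight of b could be moved to a. *)
Lemma rigid_pair (a b : X) : cl a = cl b -> w a != 0 -> w b != 0 -> a != b ->
  ~ (gap_ahead w a <= gap_ahead w b /\ gap_behind w a <= gap_behind w b).
Proof.
move=> ab wa wb a_neq_b [le_ahead le_behind].
have sumE (h : X -> R) : \sum_(x | cl x == cl a)
    ((x == a)%:R - (x == b)%:R) * h x = h a - h b.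
  rewrite (bigD1 a) //= (bigD1 b) /=; last by rewrite -ab eqxx eq_sym.
  rewrite !eqxx (eq_sym b a) (negbTE a_neq_b) big1 => [|x]; first by rewrite /=; ring.
  by case/andP=> /andP[_ /negbTE->] /negbTE->; rewrite subrr mul0r.
have zero := @rigid_cluster (cl a) (fun x => (x == a)%:R - (x == b)%:R).
suff : ((a == a)%:R - (a == b)%:R : R) = 0.
  by rewrite eqxx (negbTE a_neq_b) subr0 => /eqP; rewrite oner_eq0.
apply: zero => [x|||]; last 2 first.
- by rewrite sumE; lra.
- by rewrite sumE; lra.
- have [->|_] := eqVneq x a; first by [].
  by have [->|_] := eqVneq x b; rewrite ?ab // subrr eqxx.
- by have := sumE (fun=> 1); rewrite subrr => {2}<-; apply: eq_bigr => x _;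
    rewrite mulr1.
Qed.

(** Three vertices leave a nonzero direction that preserves both the total weight
and the missing weight ahead; up to its sign it does not increase the missing
weight behind. *)
Lemma rigid_triple (a b c : X) : cl a = cl b -> cl b = cl c ->
    w a != 0 -> w b != 0 -> w c != 0 ->
  [|| a == b, b == c | a == c].
Proof.
move=> ab bc wa wb wc; apply/negP => /negP; rewrite !negb_or => /and3P[a_b b_c a_c].
pose z (s : R) x := s * ((x == a)%:R * (gap_ahead w b - gap_ahead w c)
  + (x == b)%:R * (gap_ahead w c - gap_ahead w a)
  + (x == c)%:R * (gap_ahead w a - gap_ahead w b)).
have sumE s (h : X -> R) : \sum_(x | cl x == cl a) z s x * h x =
    s * ((gap_ahead w b - gap_ahead w c) * h a
       + (gap_ahead w c - gap_ahead w a) * h b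
       + (gap_ahead w a - gap_ahead w b) * h c).
  rewrite (bigD1 a) //= (bigD1 b) /=; last by rewrite -ab eqxx eq_sym.
  rewrite (bigD1 c) /=; last by rewrite -bc -ab eqxx eq_sym a_c eq_sym.
  rewrite /z !eqxx (eq_sym b a) (eq_sym c a) (eq_sym c b).
  rewrite (negbTE a_b) (negbTE b_c) (negbTE a_c).
  rewrite big1 => [|x]; first by rewrite /=; ring.
  case/andP=> /andP[/andP[_ /negbTE->] /negbTE->] /negbTE->.
  by rewrite !mul0r !addr0 mulr0 mul0r.
pose d := (gap_ahead w b - gap_ahead w c) * gap_behind w a
       + (gap_ahead w c - gap_ahead w a) * gap_behind w b
       + (gap_ahead w a - gap_ahead w b) * gap_behind w c.
have [s [s_neq0 s_le0]] : exists s : R, s != 0 /\ s * d <= 0.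
  have [d_le0|d_gt0] := leP d 0.
    by exists 1; rewrite oner_eq0 mul1r.
  by exists (- 1); rewrite oppr_eq0 oner_eq0 mulN1r oppr_le0 ltW.
have z0 : z s a = 0.
  apply: (@rigid_cluster (cl a)) => [x|||]; last 2 first.
  - by rewrite sumE; lra.
  - by rewrite sumE.
  - have [->//|xa] := eqVneq x a.
    have [->//|xb] := eqVneq x b.
    have [->//|xc] := eqVneq x c; first by rewrite ab bc.
    by rewrite /z (negbTE xa) (negbTE xb) (negbTE xc) !mul0r !addr0 mulr0 eqxx.
  - have := sumE s (fun=> 1); rewrite !mulr1 => zE.
    transitivity (\sum_(x | cl x == cl a) z s x * 1); last by rewrite zE; ring.
    by apply: eq_bigr => x _; rewrite mulr1.
move: z0; rewrite /z eqxx (negbTE a_b) (negbTE a_c) !mul0r !addr0 mul1r => /eqP.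
rewrite mulf_eq0 (negbTE s_neq0) /= subr_eq0 => /eqP bc_eq.
have := rigid_pair bc wb wc b_c; have := rigid_pair (esym bc) wc wb.
rewrite eq_sym => /(_ b_c); rewrite bc_eq lexx.
by case: (leP (gap_behind w b) (gap_behind w c)) => [?|/ltW ?] H1 H2;
  [case: H2 | case: H1].
Qed.

Lemma rigid_clusterP (u : 'I_n) : (exists x, cl x = u /\ w x != 0) ->
  exists p : X * X, [/\ cl p.1 = u, cl p.2 = u,
      forall x, cl x = u -> w x != 0 -> x = p.1 \/ x = p.2
    & p.1 = p.2 \/ gap_ahead w p.1 < gap_ahead w p.2 /\
                   gap_behind w p.2 < gap_behind w p.1].
Proof.
case=> a [au wa].
have [[b [bu wb b_a]]|only_a] := pselect (exists b, [/\ cl b = u, w b != 0 & b != a]).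
  have only x : cl x = u -> w x != 0 -> x = a \/ x = b.
    move=> xu wx; have ax : cl x = cl a by rewrite au.
    have ab : cl a = cl b by rewrite au.
    by case/or3P: (rigid_triple ax ab wx wa wb) b_a => /eqP ->;
      [left | rewrite eqxx | right].
  have ab : cl a = cl b by rewrite au.
  have a_b : a != b by rewrite eq_sym.
  have := rigid_pair ab wa wb a_b; have := rigid_pair (esym ab) wb wa b_a.
  have [lt_ahead|lt_ahead|eq_ahead] := ltgtP (gap_ahead w a) (gap_ahead w b);
  have [lt_behind|lt_behind|eq_behind] :=
    ltgtP (gap_behind w a) (gap_behind w b) => no1 no2;
  try by [case: no1 | case: no2].
    by exists (a, b); split=> //=; right.
  exists (b, a); split=> //= [x xu wx|]; last by right.
  by case: (only x xu wx); [right | left].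
exists (a, a); split=> //= [x xu wx|]; last by left.
have [->|xa] := eqVneq x a; first by left.
by case: only_a; exists x.
Qed.
End Rigid.
End Weightings.

(** * Clusters with one or two vertices *)

(** Consecutive clusters {a, b} and {a', b'} with weights 1 - p, p and 1 - q, q;
the booleans tell which of the pairs aa', ab', ba', bb' are missing.  By the
two strict inequalities, b misses a vertex ahead and a' misses one behind, and
neither a nor b' is isolated from the other cluster.  Hence either ba' is
missing, or exactly aa' and bb' are missing and p < 1/2 < q; if only ab' and
ba' are missing, then q < 1/2 < p. *)
Lemma two_point_edge (R : realType) (p q s : R) (aa ab ba bb : bool) :
    0 <= p <= 1 -> 0 <= q <= 1 ->
    (1 - p) * (1 - q) *+ aa + (1 - p) * q *+ ab
      + p * (1 - q) *+ ba + p * q *+ bb <= s ->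
    (1 - q) *+ aa + q *+ ab < (1 - q) *+ ba + q *+ bb ->
    (1 - p) *+ ab + p *+ bb < (1 - p) *+ aa + p *+ ba ->
  [/\ p * (1 - q) <= s, aa -> 1 - q <= s, bb -> p <= s,
      aa -> bb -> ba -> 1 - s <= q * (1 - p)
    & ~~ aa -> ~~ bb -> ab -> q < 2^-1 < p].
Proof.
move=> /andP[p_ge0 p_le1] /andP[q_ge0 q_le1].
have pq : 0 <= p * q by exact: mulr_ge0.
have pq' : 0 <= p * (1 - q) by apply: mulr_ge0 => //; lra.
have p'q : 0 <= (1 - p) * q by apply: mulr_ge0 => //; lra.
have p'q' : 0 <= (1 - p) * (1 - q) by apply: mulr_ge0; lra.
case: aa; case: ab; case: ba; case: bb; rewrite ?mulr1n ?mulr0n => gap_le ahead behind.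
all: split=> //; try by move=> *; nra.
all: try by move=> *; lra.
Qed.

Section TwoPoint.
Variables (R : realType) (n : nat) (X : finType) (cl : X -> 'I_n) (adj : rel X).
Variables (r : 'I_n -> R) (w : X -> R).
Hypotheses (n_ge3 : (3 <= n)%N) (n_gt0 : (0 < n)%N) (adj_sym : symmetric adj).
Hypothesis no_transversal : ~ exists phi : 'I_n -> X,
  (forall u, cl (phi u) = u) /\ (forall u v, cycle_adj u v -> adj (phi u) (phi v)).
Hypothesis w_adm : admissible cl adj r w.
Let cy := cyc n_gt0.

Lemma no_forward_transversal (phi : 'I_n -> X) : (forall u, cl (phi u) = u) ->
  exists u, ~~ adj (phi u) (phi (ordS u)).
Proof.
move=> phi_cl; apply: contrapT => /forallNP phi_adj; apply: no_transversal.
exists phi; split=> // u u' /orP[] /eqP ->.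
  by apply/negPn/negP/phi_adj.
by rewrite adj_sym; apply/negPn/negP/phi_adj.
Qed.

Lemma no_closed_walk (v : nat) (t : nat -> X) :
    (forall i, (i < n)%N -> cl (t i) = cy (v + i)) ->
    (forall i, (i.+1 < n)%N -> adj (t i) (t i.+1)) ->
  ~~ adj (t n.-1) (t 0%N).
Proof.
move=> t_cl t_adj; apply/negP => t_last.
pose c := (n - v %% n)%N; pose idx (u : 'I_n) := ((u + c) %% n)%N.
have idx_lt u : (idx u < n)%N by rewrite ltn_mod.
have idxE u : cy (v + idx u) = u.
  apply: val_inj; rewrite /= /idx modnDmr -modnDml.
  have -> : (v %% n + (u + c) = u + n)%N by rewrite /c; have := ltn_pmod v n_gt0; lia.
  by rewrite modnDr modn_small.
have idxS u : idx (ordS u) = ((idx u).+1 %% n)%N.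
  by rewrite /idx /= modnDml -(addn1 ((u + c) %% n)) modnDml addn1 addSn.
have [u] := @no_forward_transversal (t \o idx) (fun u => etrans (t_cl _ (idx_lt
  u)) (idxE u)).
move=> /negP; apply; rewrite /= idxS.
have [lt_Sn|ge_Sn] := ltnP (idx u).+1 n; first by rewrite modn_small ?t_adj.
have -> : idx u = n.-1 by have := idx_lt u; lia.
by rewrite prednK // modnn.
Qed.

(** The vertices reached from x after a full turn do not include x, so they have
total weight zero. *)
Lemma single_point_blocked (v : nat) (x : X) :
    (forall y, cl y = cy v -> w y != 0 -> y = x) -> cl x = cy v ->
  blocked (fun i => r (cy (v + i))) n.
Proof.
move=> x_only x_cl; have [w_ge0 w_sum w_gap] := w_adm.
pose reach k y := exists t : nat -> X, [/\ t 0%N = x, t k = y,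
  forall i, (i <= k)%N -> cl (t i) = cy (v + i)
  & forall i, (i < k)%N -> adj (t i) (t i.+1)].
pose beta k := \sum_(y | (cl y == cy (v + k)) && `[< reach k y >]) w y.
have reachS k y z : reach k y -> cl z = cy (v + k.+1) -> adj y z -> reach k.+1 z.
  case=> t [t0 tk t_cl t_adj] z_cl yz.
  exists (fun i => if (i <= k)%N then t i else z); split=> [|||i].
  - by rewrite leq0n.
  - by rewrite ltnn.
  - move=> i; case: (leqP i k) => [le_ik _|lt_ki le_ik]; first exact: t_cl.
    by have -> : i = k.+1 by lia.
  - rewrite ltnS => le_ik; rewrite le_ik; case: ltngtP le_ik => // [lt_ik|->] _.
      exact: t_adj.
    by rewrite tk.
have wx : w x = 1.
  rewrite -(w_sum (cy v)) (bigD1 x) ?x_cl //= big1 ?addr0 // => y /andP[/eqP y_cl].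
  by apply: contraNeq => /x_only ->.
have betaC k : 1 - beta k = \sum_(y | (cl y == cy (v + k)) && ~~ `[< reach k y >]) w y.
  rewrite -(w_sum (cy (v + k))) (bigID (fun y => `[< reach k y >])) /=.
  by rewrite [X in X - _]addrC addrK.
exists beta; split.
- move=> k; apply/andP; split; first by apply: sumr_ge0.
  by rewrite -subr_ge0 betaC; apply: sumr_ge0.
- rewrite /beta (bigD1 x) /=; last first.
    rewrite addn0 x_cl eqxx; apply/asboolP; exists (fun=> x); split=> // i.
    by rewrite leqn0 => /eqP ->; rewrite addn0.
  by rewrite wx big1 ?addr0 // => y /andP[/andP[_ /asboolP[t [-> ->]]]]; rewrite eqxx.
- rewrite /beta big1 // => y /andP[/eqP + /asboolP[t [t0 tn t_cl t_adj]]].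
  rewrite /cy cyc_period => y_cl; apply/eqP; apply: contraT => /(x_only _ y_cl) yx.
  have /negP[] := @no_closed_walk v t (fun i lt_in => t_cl i (ltnW lt_in))
    (fun i lt_in => t_adj i (ltnW lt_in)).
  by rewrite t0 -yx -tn -{2}(prednK n_gt0) t_adj // prednK.
- move=> k _; apply: le_trans (w_gap _); rewrite betaC /gap /cy ordS_cyc -addnS -/cy.
  rewrite mulr_suml (bigID (fun y => `[< reach k y >]) [pred y | cl y == _]) /=.
  rewrite ler_wpDr ?sumr_ge0 // => [y _|].
    by apply: sumr_ge0 => z _; apply: mulr_ge0.
  apply: ler_sum => y /andP[_ /asboolP y_reach]; rewrite mulr_sumr.
  rewrite big_mkcond [leRHS]big_mkcond; apply: ler_sum => z _.
  case: eqP => //= z_cl; have [z_reach|z_nreach] := asboolP; first by case: ifP;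
    rewrite ?mulr_ge0.
  rewrite ifT //; apply/negP => yz; apply: z_nreach; exact: reachS y_reach z_cl yz.
Qed.

Variables (a b : 'I_n -> X).
Hypotheses (a_cl : forall u, cl (a u) = u) (b_cl : forall u, cl (b u) = u).
Hypothesis ab_only : forall x, w x != 0 -> x = a (cl x) \/ x = b (cl x).
Hypothesis ab_ahead : forall u, gap_ahead cl adj w (a u) < gap_ahead cl adj w (b u).
Hypothesis ab_behind : forall u, gap_behind cl adj w (b u) < gap_behind cl adj w (a u).

Lemma sum_two_point (u : 'I_n) (h : X -> R) :
  \sum_(x | cl x == u) w x * h x = w (a u) * h (a u) + w (b u) * h (b u).
Proof.
have a_b : a u != b u.
  by apply/eqP => ab; have := ab_ahead u; rewrite ab ltxx.
rewrite (bigD1 (a u)) ?a_cl //= (bigD1 (b u)) /=; last first.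
  by rewrite b_cl eqxx eq_sym.
rewrite big1 ?addr0 // => x /andP[/andP[/eqP xu x_a] x_b].
have [->|/ab_only] := eqVneq (w x) 0; first by rewrite mul0r.
by rewrite xu => -[xE|xE]; [rewrite xE eqxx in x_a | rewrite xE eqxx in x_b].
Qed.

Lemma sum_two_point_cond (u : 'I_n) (P : pred X) :
  \sum_(x | (cl x == u) && P x) w x = w (a u) *+ P (a u) + w (b u) *+ P (b u).
Proof.
rewrite -[w (a u) *+ _]mulr_natr -[w (b u) *+ _]mulr_natr -(sum_two_point u (fun
  x => (P x)%:R)) big_mkcondr.
by apply: eq_bigr => x _; rewrite mulr_natr mulrb.
Qed.

Lemma two_point_edge_facts (u : 'I_n) (nadj := fun x y : X => ~~ adj x y)
    (p := w (b u)) (q := w (b (ordS u))) :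
  [/\ p * (1 - q) <= r u,
      nadj (a u) (a (ordS u)) -> 1 - q <= r u,
      nadj (b u) (b (ordS u)) -> p <= r u,
      nadj (a u) (a (ordS u)) -> nadj (b u) (b (ordS u)) ->
        nadj (b u) (a (ordS u)) -> 1 - r u <= q * (1 - p)
    & adj (a u) (a (ordS u)) -> adj (b u) (b (ordS u)) ->
        nadj (a u) (b (ordS u)) -> q < 2^-1 < p].
Proof.
have [w_ge0 w_sum w_gap] := w_adm.
have waE u' : w (a u') = 1 - w (b u').
  rewrite -(w_sum u') -(addrK (w (b u')) (w (a u'))); congr (_ - _).
  rewrite -[w (a u')]mulr1 -[w (b u')]mulr1 -(sum_two_point u' (fun=> 1)).
  by apply: eq_bigr => x _; rewrite mulr1.
have wb01 u' : 0 <= w (b u') <= 1.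
  by rewrite w_ge0 -subr_ge0 -waE w_ge0.
have aheadE x : cl x = u -> gap_ahead cl adj w x =
    (1 - q) *+ nadj x (a (ordS u)) + q *+ nadj x (b (ordS u)).
  by move=> xu; rewrite /gap_ahead xu sum_two_point_cond waE.
have behindE y : cl y = ordS u -> gap_behind cl adj w y =
    (1 - p) *+ nadj (a u) y + p *+ nadj (b u) y.
  move=> yu; rewrite /gap_behind yu -waE -(sum_two_point_cond u (fun x => nadj x y)).
  by apply: eq_bigl => x; rewrite (inj_eq (@ordS_inj n)).
have ahead := ab_ahead u; have behind := ab_behind (ordS u).
rewrite (aheadE _ (a_cl u)) (aheadE _ (b_cl u)) in ahead.
rewrite (behindE _ (a_cl _)) (behindE _ (b_cl _)) in behind.
have gap_le := w_gap u.
rewrite gapE_ahead sum_two_point (aheadE _ (a_cl u)) (aheadE _ (b_cl u)) in gap_le.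
rewrite waE -/p !mulrDr !mulrnAr addrA in gap_le.
have [f1 f2 f3 f4 f5] := two_point_edge (wb01 u) (wb01 (ordS u)) gap_le ahead behind.
by split=> // aa bb ab; apply: f5 => //; rewrite negbK.
Qed.

(** A missing edge aa at k and a missing edge bb at l <> k cut out a stretch on
which the vertices b are forced after k and impossible at l.  If k and l can only
be the same i, all other places have aa and bb; if moreover ba is present at i,
one ab elsewhere closes up a transversal, and ab cannot be missing at both i+1
and i+2, since the first forces the weight of b at i+2 below 1/2 and the
second forces it above 1/2. *)
Lemma two_point_blocked : exists v, blocked (fun i => r (cy (v + i))) n.
Proof.
have [w_ge0 w_sum w_gap] := w_adm.
have wb01 u : 0 <= w (b u) <= 1.
  rewrite w_ge0 /= -(w_sum u) (bigD1 (b u)) ?b_cl //= lerDl.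
  exact: sumr_ge0.
have [i aa_i] := no_forward_transversal a_cl.
have [j bb_j] := no_forward_transversal b_cl.
apply: contrapT => unblocked.
have same k l : ~~ adj (a k) (a (ordS k)) -> ~~ adj (b l) (b (ordS l)) -> k = l.
  move=> aa_k bb_l; have [//|k_l] := eqVneq k l; exfalso; apply: unblocked.
  pose d := ((l + n - k) %% n)%N.
  have kd : cy (k + d) = l.
    apply: val_inj; rewrite /= /d modnDmr.
    have -> : (k + (l + n - k) = l + n)%N by have := ltn_ord k; lia.
    by rewrite modnDr modn_small.
  have k0 : cy k = k by exact: cyc_ord.
  have d_gt0 : (0 < d)%N.
    by rewrite lt0n; apply: contra_neq k_l => d0; rewrite -kd d0 addn0 k0.
  have d_lt : (d < n)%N by rewrite ltn_mod.
  exists k; exists (fun m => if m == 0%N then 1 else if (m <= d)%N then w (b (cy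
    (k + m))) else 0).
  split=> //.
  - by move=> m; case: ifP => _; [lra | case: ifP => _; [|lra]].
  - by rewrite gtn_eqF // leqNgt d_lt.
  - move=> m lt_mn; have [mid start finish _ _] := two_point_edge_facts (cy (k + m)).
    have -> : cy (k + m.+1) = ordS (cy (k + m)) by rewrite addnS /cy ordS_cyc.
    have [m0|m_gt0] := posnP m.
      by rewrite m0 /= d_gt0 mul1r; move: start; rewrite m0 addn0 k0; apply.
    case: (ltngtP m d) => [lt_md|gt_md|m_d].
    + by [].
    + by rewrite mul0r; apply: le_trans mid; apply: mulr_ge0;
      have := wb01 (cy (k + m)); have := wb01 (ordS (cy (k + m))); lra.
    + by rewrite subr0 mulr1; apply: finish; rewrite m_d kd.
have ji : j = i by apply/esym/same.
rewrite {}ji in bb_j.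
have aa k : k != i -> adj (a k) (a (ordS k)).
  by apply: contraNT => aa_k; apply/eqP/same.
have bb k : k != i -> adj (b k) (b (ordS k)).
  by apply: contraNT => bb_k; apply/eqP/esym/same.
have i0 : cy i = i by exact: cyc_ord.
have cyS k : cy k.+1 = ordS (cy k) by rewrite /cy ordS_cyc.
have in_turn m : (0 < m < n)%N -> cy (i + m) != i.
  move=> /andP[m_gt0 m_lt]; apply: contraTneq m_gt0;
    rewrite -[RHS]i0 -[in RHS](addn0 i).
  by move/cyc_addlI => ->.
have [_ _ _ open_i _] := two_point_edge_facts i.
have [ba_i|ba_i] := boolP (adj (b i) (a (ordS i))); last first.
  have [|||||bl|bl] := @one_open_edge_blocked R n (fun k => r (cy (i + k))) (fun
    k => w (b (cy (i + k)))) n_ge3.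
  - move=> k; have [mid _ _ _ _] := two_point_edge_facts (cy (i + k)).
    apply: le_trans mid; apply: mulr_ge0; have := wb01 (cy (i + k));
      have := wb01 (ordS (cy (i + k))); lra.
  - by rewrite /cy cyc_period addn0.
  - by [].
  - by move=> k _; have [mid _ _ _ _] := two_point_edge_facts (cy (i + k));
      rewrite addnS cyS.
  - by rewrite /cy cyc_period -/cy addn0 i0 addn1 cyS i0 open_i.
  - by apply: unblocked; exists i.
  - by apply: unblocked; exists i.+1; move: bl; under eq_fun do rewrite addnS -addSn.
(* Otherwise follow a from i+1 to i+1+d, switch to b and come back to b i. *)
have no_switch d : (d < 2)%N -> ~~ adj (a (cy (i.+1 + d))) (b (cy (i.+1 + d.+1))).
  move=> d_lt; apply/negP => switch.
  pose t m := if (m <= d)%N then a (cy (i.+1 + m)) else b (cy (i.+1 + m)).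
  suff : ~~ adj (t n.-1) (t 0%N).
    have -> : t n.-1 = b i.
      have -> : t n.-1 = b (cy (i.+1 + n.-1)) by rewrite /t ifN //; lia.
      have -> : (i.+1 + n.-1 = i + n)%N by lia.
      by rewrite /cy cyc_period -/cy i0.
    by rewrite /t leq0n addn0 cyS i0 ba_i.
  apply: (@no_closed_walk i.+1) => m lt_mn; first by rewrite /t; case: ifP.
  have m_turn : cy (i.+1 + m) != i by rewrite addSnnS; apply: in_turn.
  rewrite /t; case: (ltngtP m d) => [lt_md|gt_md|->].
  - by rewrite addnS cyS; apply: aa.
  - by rewrite addnS cyS; apply: bb.
  - by [].
have half d : (d < 2)%N -> w (b (cy (i.+1 + d.+1))) < 2^-1 < w (b (cy (i.+1 + d))).
  move=> d_lt; have [_ _ _ _ perm] := two_point_edge_facts (cy (i.+1 + d)).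
  have d_turn : cy (i.+1 + d) != i.
    by rewrite addSnnS; apply: in_turn; apply: leq_trans n_ge3.
  rewrite addnS cyS; apply: perm; [exact: aa | exact: bb |].
  by have := no_switch d d_lt; rewrite addnS cyS.
by have := half 0%N isT; have := half 1%N isT; lra.
Qed.
End TwoPoint.

(** * Cycles *)

Theorem theorem5p10 (R : realType) (n : nat) (hn : (3 <= n)%N)
    (gamma : 'I_n -> 'I_n -> R)
    (gamma_sym : forall u v, cycle_adj u v -> gamma u v = gamma v u)
    (gamma_01 : forall u v, cycle_adj u v -> 0 <= gamma u v <= 1)
    (htrees : forall f : 'I_n -> 'I_n, proper_labeling (@cycle_adj n) f ->
       ensures_transversal (@mpt_adj n 'I_n (@cycle_adj n) f)
         (@mpt_weight R n 'I_n (@cycle_adj n) gamma f)) :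
  ensures_transversal (@cycle_adj n) gamma.
Proof.
move=> G G_dense; apply: contrapT => no_transversal.
have n_gt0 : (0 < n)%N by apply: leq_trans hn.
have n_gt1 : (1 < n)%N by apply: leq_trans hn.
pose r u := 1 - gamma u (ordS u).
have unblocked v : ~ blocked (fun i => r (cyc n_gt0 (v + i))) n.
  have := unblocked_of_trees hn gamma_sym (htrees _ (cut_labeling_proper n_gt0 v)).
  by under eq_fun do rewrite -ordS_cyc.
have G_adm : admissible (@cluster _ _ _ G) (@badj _ _ _ G) r (@bweight _ _ _ G).
  split=> [||u]; [exact: bweight_ge0 | exact: cluster_weight |].
  have := G_dense u (ordS u); rewrite /cycle_adj eqxx => /(_ isT) dense.
  have : gap (@cluster _ _ _ G) (@badj _ _ _ G) (@bweight _ _ _ G) (@bweight _ _ _ G) u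
      + density G u (ordS u) = 1.
    rewrite /gap /density addrC -big_split -[RHS](cluster_weight G u) /=.
    apply: eq_bigr => x _; rewrite -(bigID (fun y => badj x y)) /= -mulr_sumr.
    by rewrite cluster_weight mulr1.
  by rewrite /r; lra.
have [w [w_adm w_rigid]] := admissible_rigid G_adm.
have [w_ge0 w_sum w_gap] := w_adm.
have cluster_pair u : exists p, [/\ cluster p.1 = u, cluster p.2 = u,
    forall x : bvertex G, cluster x = u -> w x != 0 -> x = p.1 \/ x = p.2
  & p.1 = p.2 \/ gap_ahead (@cluster _ _ _ G) (@badj _ _ _ G) w p.1
                 < gap_ahead (@cluster _ _ _ G) (@badj _ _ _ G) w p.2 /\
                gap_behind (@cluster _ _ _ G) (@badj _ _ _ G) w p.2
                 < gap_behind (@cluster _ _ _ G) (@badj _ _ _ G) w p.1].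
  apply: (rigid_clusterP n_gt1 w_rigid); apply: contrapT => /forallNP w0.
  have := w_sum u; rewrite big1 => [|x /eqP xu]; first by move/esym/eqP;
    rewrite oner_eq0.
  by apply/eqP; apply: contraT => wx; case: (w0 x).
have [pt pt_spec] := boolp.choice cluster_pair.
have [[u pt_u]|two] := pselect (exists u, (pt u).1 = (pt u).2).
  have [p1_cl _ p_only _] := pt_spec u.
  apply: (unblocked u);
    apply: (single_point_blocked hn (@badj_sym _ _ _ G) no_transversal w_adm (x
      := (pt u).1)).
    by move=> y; rewrite cyc_ord => y_cl /(p_only _ y_cl) []; rewrite -?pt_u.
  by rewrite cyc_ord.
have two' u : (pt u).1 <> (pt u).2 by move=> pt_u; apply: two; exists u.
have [|||||v] := @two_point_blocked R n _ _ _ r w hn n_gt0 (@badj_sym _ _ _ G)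
  no_transversal w_adm (fun u => (pt u).1) (fun u => (pt u).2).
- by move=> u; have [] := pt_spec u.
- by move=> u; have [] := pt_spec u.
- by move=> x wx; have [_ _ only _] := pt_spec (cluster x); apply: only.
- by move=> u; have [_ _ _ [/two'|[]]] := pt_spec u.
- by move=> u; have [_ _ _ [/two'|[]]] := pt_spec u.
- exact: unblocked.
Qed.
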